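(* Let $L$ be a loop with Nuclear-holomorph $H(L)$. Then $L$ is a Bol-SBL if and only if $H(L)$ is a Bol-SBL.
   Context: Mappings are written on the right, so $\alpha\beta$ means first $\alpha$, then $\beta$. For a loop $(L,\cdot)$ let $Aum(L,\cdot)$ be its automorphism group. The holomorph $H(L)=(H,\circ)$ is the loop on the set $H$ of pairs $(\alpha,x)$ with $\alpha\in Aum(L,\cdot)$, $x\in L$, with operation $(\alpha,x)\circ(\beta,y)=(\alpha\beta,\ x\beta\cdot y)$. The symbol $x^{-1}$ denotes the two-sided inverse of $x$ (assumed to exist in $L$). The nucleus $N(L)$ is the set of $a\in L$ with $a\cdot xy=ax\cdot y$, $x\cdot ay=xa\cdot y$, $x\cdot ya=xy\cdot a$ for all $x,y\in L$. $H(L)$ is called a Nuclear-holomorph of $L$ if $x^{-1}\cdot x\alpha\in N(L)$ or $x\alpha\cdot x^{-1}\in N(L)$ for all $x\in L$ and $\alpha\in Aum(L,\cdot)$. A Bol loop is a loop satisfying the (right) Bol identity $(xy\cdot z)y=x(yz\cdot y)$. A loop is a Smarandache Bol loop (SBL) if it has at least one non-trivial subloop that is a Bol loop. A Bol-SBL is a loop that is both a Bol loop and a SBL. *)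

(* Defs.v *)
From HB Require Import structures.
From mathcomp Require Import all_boot.
From mathcomp Require Import boolp.

Set Implicit Arguments.
Unset Strict Implicit.
Unset Printing Implicit Defensive.

Local Open Scope group_scope.

(* Built on baseUMagmaType rather than umagmaType, because the latter forces a
   choiceType structure on the carrier. *)
HB.mixin Record BaseUMagma_isLoop L of BaseUMagma L := {
  loop1l : left_id 1 (@mul L);
  loop1r : right_id 1 (@mul L);
  loop_divl : forall a b : L, exists! x, a * x = b;
  loop_divr : forall a b : L, exists! x, x * a = b
}.

#[short(type="loopType")]
HB.structure Definition Loop := {L of BaseUMagma_isLoop L & BaseUMagma L}.

Section LoopTheory.
Variable L : loopType.
Implicit Types x y z : L.

Lemma loopIl x y z : x * y = x * z -> y = z.
Proof.
have [w [_ wP]] := loop_divl x (x * z).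
by move=> e; rewrite -(wP y e) -(wP z erefl).
Qed.

Lemma loopIr x y z : y * x = z * x -> y = z.
Proof.
have [w [_ wP]] := loop_divr x (z * x).
by move=> e; rewrite -(wP y e) -(wP z erefl).
Qed.

Definition two_sided_inverse x y := x * y = 1 /\ y * x = 1.

Definition has_inverses := forall x, exists y, two_sided_inverse x y.

Definition in_nucleus (a : L) := forall x y,
  [/\ a * (x * y) = (a * x) * y,
      x * (a * y) = (x * a) * y &
      x * (y * a) = (x * y) * a].

Definition bol := forall x y z, ((x * y) * z) * y = x * ((y * z) * y).

Definition nontrivial := exists x, x <> 1.

Record loop_aut := LoopAut {
  aut_fun :> L -> L;
  aut_morph : {morph aut_fun : x y / x * y};
  aut_bij : bijective aut_fun
}.

Lemma loop_aut_eq (f g : loop_aut) : f =1 g -> f = g.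
Proof.
case: f g => [f fM fB] [g gM gB] /= /funext fg; rewrite -{}fg in gM gB *.
by rewrite (Prop_irrelevance fM gM) (Prop_irrelevance fB gB).
Qed.

Lemma loop_aut1 (f : loop_aut) : f 1 = 1.
Proof. by apply: (@loopIl (f 1)); rewrite -aut_morph !loop1r. Qed.

Definition loop_aut_id : loop_aut :=
  @LoopAut id (fun _ _ => erefl) (Bijective (fun=> erefl) (fun=> erefl)).

(* Maps are written on the right: [aut_mul f g] is first [f], then [g]. *)
Lemma aut_mul_morph (f g : loop_aut) : {morph g \o f : x y / x * y}.
Proof. by move=> x y /=; rewrite !aut_morph. Qed.

Definition aut_mul (f g : loop_aut) : loop_aut :=
  @LoopAut (g \o f) (@aut_mul_morph f g) (bij_comp (aut_bij g) (aut_bij f)).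

Lemma aut_inv_ex (f : loop_aut) :
  exists g : loop_aut, cancel f g /\ cancel g f.
Proof.
case: (aut_bij f) => g fK gK.
have gM : {morph g : x y / x * y}.
  by move=> x y; apply: (can_inj fK); rewrite aut_morph !gK.
by exists (@LoopAut g gM (Bijective gK fK)).
Qed.

Definition holomorph : Type := (loop_aut * L)%type.

Definition holomorph_mul (p q : holomorph) : holomorph :=
  (aut_mul p.1 q.1, q.1 p.2 * q.2).

Definition holomorph_one : holomorph := (loop_aut_id, 1).

End LoopTheory.

Section HolomorphLoop.
Variable L : loopType.

HB.instance Definition _ := hasMul.Build (holomorph L) (@holomorph_mul L).
HB.instance Definition _ := hasOne.Build (holomorph L) (holomorph_one L).

Fact holomorph1l : left_id 1 (@mul (holomorph L)).
Proof.
case=> f x; congr (_, _); first exact: loop_aut_eq.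
by rewrite /= loop_aut1 loop1l.
Qed.

Fact holomorph1r : right_id 1 (@mul (holomorph L)).
Proof.
by case=> f x; congr (_, _); [exact: loop_aut_eq | rewrite /= loop1r].
Qed.

Fact holomorph_divl (p q : holomorph L) : exists! r, p * r = q.
Proof.
case: p q => f x [g y]; have [f' [fK f'K]] := aut_inv_ex f.
have [z [zP zU]] := loop_divl (aut_mul f' g x) y.
exists (aut_mul f' g, z); split.
  by congr (_, _) => //; apply: loop_aut_eq => t /=; rewrite fK.
case=> h w [] e1 e2.
have <- : h = aut_mul f' g.
  by apply: loop_aut_eq => t /=; rewrite -e1 /= f'K.
congr (_, _); apply: zU; rewrite -e2 /=.
by rewrite -e1 /= f'K.
Qed.

Fact holomorph_divr (p q : holomorph L) : exists! r, r * p = q.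
Proof.
case: p q => f x [g y]; have [f' [fK f'K]] := aut_inv_ex f.
have [z [zP zU]] := loop_divr x y.
exists (aut_mul g f', f' z); split.
  congr (_, _); last by rewrite /= f'K.
  by apply: loop_aut_eq => t /=; rewrite f'K.
case=> h w [] e1 e2.
congr (_, _); first by apply: loop_aut_eq => t /=; rewrite -e1 /= fK.
by rewrite (zU (f w)) ?fK.
Qed.

HB.instance Definition _ := BaseUMagma_isLoop.Build (holomorph L)
  holomorph1l holomorph1r holomorph_divl holomorph_divr.

End HolomorphLoop.

(* A subset of L that is a loop for the operation of L: [sub_divl] and
   [sub_divr] say that the solutions in L of a * x = b and x * a = b lie in the
   subset whenever a and b do. *)
Record subloop (L : loopType) := Subloop {
  sub_mem :> L -> Prop;
  sub_one : sub_mem 1;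
  sub_mul : forall a b, sub_mem a -> sub_mem b -> sub_mem (a * b);
  sub_divl : forall a x, sub_mem a -> sub_mem (a * x) -> sub_mem x;
  sub_divr : forall a x, sub_mem a -> sub_mem (x * a) -> sub_mem x
}.

Definition subloop_type (L : loopType) (S : subloop L) : Type := {x : L | S x}.

Section SubloopLoop.
Variables (L : loopType) (S : subloop L).
Local Notation T := (subloop_type S).

Definition subloop_mul (a b : T) : T :=
  exist _ (sval a * sval b) (sub_mul (svalP a) (svalP b)).

HB.instance Definition _ := hasMul.Build T subloop_mul.
HB.instance Definition _ := hasOne.Build T (exist _ 1 (sub_one S)).

Fact subloop_eq (a b : T) : sval a = sval b -> a = b.
Proof.
by case: a b => [a Sa] [b Sb] /= e; subst b; rewrite (Prop_irrelevance Sa Sb).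
Qed.

Fact subloop1l : left_id 1 (@mul T).
Proof. by move=> a; apply: subloop_eq; rewrite /= loop1l. Qed.

Fact subloop1r : right_id 1 (@mul T).
Proof. by move=> a; apply: subloop_eq; rewrite /= loop1r. Qed.

Fact subloop_divl (a b : T) : exists! x, a * x = b.
Proof.
have [x [xP xU]] := loop_divl (sval a) (sval b).
have Sx : S x by apply: (sub_divl (svalP a)); rewrite xP; exact: svalP.
exists (exist _ x Sx); split; first exact: subloop_eq.
by move=> y e; apply: subloop_eq; apply: xU; rewrite -e.
Qed.

Fact subloop_divr (a b : T) : exists! x, x * a = b.
Proof.
have [x [xP xU]] := loop_divr (sval a) (sval b).
have Sx : S x by apply: (sub_divr (svalP a)); rewrite xP; exact: svalP.
exists (exist _ x Sx); split; first exact: subloop_eq.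
by move=> y e; apply: subloop_eq; apply: xU; rewrite -e.
Qed.

HB.instance Definition _ := BaseUMagma_isLoop.Build T
  subloop1l subloop1r subloop_divl subloop_divr.

End SubloopLoop.

(* "Non-trivial" excludes only the subloop {1}; L itself is allowed. With
   proper subloops instead, the cyclic group of order 3 would not be a
   Smarandache Bol loop while its holomorph, of order 6, would be one. *)
Definition smarandache_bol (L : loopType) :=
  exists S : subloop L, nontrivial (subloop_type S) /\ bol (subloop_type S).

Definition bol_sbl (L : loopType) := bol L /\ smarandache_bol L.

(* [x'] ranges over the two-sided inverses of [x], of which there is at most
   one; that they exist is [has_inverses]. *)
Definition nuclear_holomorph (L : loopType) :=
  forall (x x' : L) (f : loop_aut L), two_sided_inverse x x' ->
    in_nucleus (x' * f x) \/ in_nucleus (f x * x').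

(* Main.v *)
Require Import Defs.
From HB Require Import structures.
From mathcomp Require Import all_boot.
From mathcomp Require Import boolp.

(** A Bol loop is a Smarandache Bol loop exactly when it is non-trivial
    ([bol_sblE]), since the whole loop is then a witness. So the theorem says
    that the Bol identity and non-triviality both pass between [L] and
    [holomorph L].

    Expanding the Bol identity of the holomorph at [(a, x)], [(b, y)],
    [(c, z)] and comparing second coordinates gives an identity of [L],
    [((X * f y) * Z) * y = X * ((f y * Z) * y)],
    in which [f] is [c] followed by [b], while [X] and [Z] are images of [x]
    and [z] under automorphisms. It is the Bol identity with the first
    occurrence of [y] on each side moved by [f]. The nuclear hypothesis says that [f y]
    is [y * n] or [n * y] with [n] in the nucleus ([aut_nuclear_translate]), and
    a nuclear factor can be carried out of the way and back, which reduces the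
    twisted identity to the ordinary one ([bol_twisted]). Conversely, pairs
    whose first coordinate is the identity form a copy of [L]. *)

Set Implicit Arguments.
Unset Strict Implicit.
Unset Printing Implicit Defensive.

Local Open Scope group_scope.

Definition full_subloop (L : loopType) : subloop L :=
  @Subloop L (fun=> True) I (fun _ _ _ _ => I) (fun _ _ _ _ => I)
    (fun _ _ _ _ => I).

Lemma bol_sblE (L : loopType) : bol_sbl L <-> bol L /\ nontrivial L.
Proof.
split=> [[bolL [S [[x xN1] _]]] | [bolL [x xN1]]]; split=> //.
  by exists (sval x) => x1; apply: xN1; apply: subloop_eq.
exists (full_subloop L); split; last first.
  by move=> a b c; apply: subloop_eq; apply: bolL.
by exists (exist _ x I) => /(congr1 sval).
Qed.

(** If [n = y' * f y] is nuclear, where [y'] is the inverse of [y], then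
    [y' * (y * n) = (y' * y) * n = y' * f y], and [y'] cancels; the other case
    is symmetric. *)
Lemma aut_nuclear_translate (L : loopType) (f : loop_aut L) (y : L) :
  has_inverses L -> nuclear_holomorph L ->
  exists2 n, in_nucleus n & f y = y * n \/ f y = n * y.
Proof.
move=> invL nucL; have [y' yy'] := invL y.
have [y_y' y'_y] := yy'.
case: (nucL y y' f yy') => nucn.
  exists (y' * f y) => //; left; apply: (@loopIl _ y').
  by have [_ _ ->] := nucn y' y; rewrite y'_y loop1l.
exists (f y * y') => //; right; apply: (@loopIr _ y').
by have [<- _ _] := nucn y y'; rewrite y_y' loop1r.
Qed.

(** With [u = y * n] the factor [n] is absorbed into [z]; with [u = n * y] it is
    absorbed into [x] and, after the Bol identity, moved back next to [y]. *)
Lemma bol_twisted (L : loopType) (n u x y z : L) :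
  bol L -> in_nucleus n -> u = y * n \/ u = n * y ->
  ((x * u) * z) * y = x * ((u * z) * y).
Proof.
move=> bolL nucn.
have nl a b : n * (a * b) = (n * a) * b by have [] := nucn a b.
have nm a b : a * (n * b) = (a * n) * b by have [] := nucn a b.
have nr a b : a * (b * n) = (a * b) * n by have [] := nucn a b.
case=> ->; first by rewrite nr -!nm bolL.
by rewrite nm bolL -nm !nl.
Qed.

Lemma bol_holomorph (L : loopType) :
  has_inverses L -> nuclear_holomorph L -> bol L -> bol (holomorph L).
Proof.
move=> invL nucL bolL [a x] [b y] [c z]; congr (_, _).
  exact: loop_aut_eq.
rewrite /= !aut_morph.
have [n nucn byE] := aut_nuclear_translate (aut_mul c b) y invL nucL.
exact: bol_twisted bolL nucn byE.
Qed.

Lemma holomorph_bol (L : loopType) : bol (holomorph L) -> bol L.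
Proof.
move=> bolH x y z; pose i (t : L) : holomorph L := (loop_aut_id L, t).
by have /(congr1 snd) := bolH (i x) (i y) (i z).
Qed.

(** A non-identity automorphism moves some element, so a trivial loop has a
    trivial holomorph. *)
Lemma nontrivial_holomorph (L : loopType) :
  nontrivial (holomorph L) <-> nontrivial L.
Proof.
split=> [[[f x] fxN1] | [x xN1]]; last first.
  by exists (loop_aut_id L, x) => /(congr1 snd).
apply: contrapT => trivL; apply: fxN1.
have all1 (t : L) : t = 1 by apply: contrapT => tN1; apply: trivL; exists t.
congr (_, _) => //; apply: loop_aut_eq => t.
by rewrite (all1 (f t)) (all1 (loop_aut_id L t)).
Qed.

Theorem theorem3p12 (L : loopType)
    (invL : has_inverses L) (nucL : nuclear_holomorph L) :
  bol_sbl L <-> bol_sbl (holomorph L).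
Proof.
rewrite !bol_sblE nontrivial_holomorph.
split=> -[bolL ntL]; split=> //; first exact: bol_holomorph.
exact: holomorph_bol.
Qed.
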